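(* Let $n,k\geq 0$ be integers and $p$ a prime. Then $A_{n+m+k,k}\equiv 0\pmod p$ for all $m=0,1,\dots,p-2$ if and only if $A_{n+m+k,k}\equiv A_{n+pm+k,k}\pmod p$ for all $m=1,2,\dots,p-1$.
   Context: A partition of a finite set is a collection of nonempty, pairwise disjoint subsets (blocks) whose union is the set; a singleton of a partition is a block with exactly one element. For integers $0\leq k\leq n$, $A_{n,k}$ denotes the number of partitions of $\{1,2,\dots,n+1\}$ whose largest singleton is $k+1$ (i.e. $\{k+1\}$ is a block and no $j>k+1$ forms a singleton block). *)

(* Defs.v *)
From mathcomp Require Import all_boot.

Set Implicit Arguments.
Unset Strict Implicit.
Unset Printing Implicit Defensive.

(* The ordinal i : 'I_n.+1 stands for the element i + 1 of {1, ..., n + 1}, so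
   the largest singleton k + 1 is the block made of the ordinal of value k. *)
Definition largest_singleton (n : nat) (P : {set {set 'I_n.+1}}) (k : nat) :
    bool :=
  [exists i : 'I_n.+1, (nat_of_ord i == k) && ([set i] \in P)]
  && [forall j : 'I_n.+1, (k < j) ==> ([set j] \notin P)].

Definition A (n k : nat) : nat :=
  #|[set P : {set {set 'I_n.+1}}
      | partition P [set: 'I_n.+1] & largest_singleton P k]|.

(* Main.v *)
(**
   Deleting the largest singleton identifies A_{m+k,k} with the number of
   partitions of an (m+k)-set having no singleton inside a fixed m-subset.
   Rotating p of the m+p marked points permutes the partitions counted by
   A_{m+p+k,k}.  A fixed partition cannot have these p points in p different
   blocks, for they would then be singletons; so it has them in one block, and
   contracting them to a single unmarked point shows
     A_{m+p+k,k} = A_{m+1+k,k} + A_{m+k,k}  (mod p).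
   Hence A_{n+pm+k,k} is congruent to the sum over j <= m of C(m,j) A_{n+j+k,k},
   and the second family of congruences is a triangular linear system in the
   A_{n+j+k,k}, j < p-1, with diagonal entries C(m,m-1) = m invertible mod p.
*)
Require Import Defs.
From mathcomp Require Import all_boot all_algebra all_fingroup all_solvable zify.

Set Implicit Arguments.
Unset Strict Implicit.
Unset Printing Implicit Defensive.

(** * Partitions without singletons in a prescribed set of marked points *)

Definition partitions_no1 (T : finType) (D U : {set T}) : {set {set {set T}}} :=
  [set P | partition P D & [forall x in U, [set x] \notin P]].

Lemma partition_eq_block (T : finType) (P : {set {set T}}) (D B B' : {set T}) x :
  partition P D -> B \in P -> B' \in P -> x \in B -> x \in B' -> B = B'.
Proof.
move=> /partition_trivIset tP PB PB' xB xB'.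
by rewrite -(def_pblock tP PB xB) (def_pblock tP PB' xB').
Qed.

Lemma partition_block_of (T : finType) (P : {set {set T}}) (D : {set T}) x :
  partition P D -> x \in D -> exists2 B, B \in P & x \in B.
Proof. by move=> /cover_partition <- /bigcupP[B PB xB]; exists B. Qed.

Lemma partitionI (T : finType) (P : {set {set T}}) (D : {set T}) :
    (forall B, B \in P -> B \subset D) ->
    (forall x, x \in D -> exists2 B, B \in P & x \in B) ->
    (forall B B' x, B \in P -> B' \in P -> x \in B -> x \in B' -> B = B') ->
    set0 \notin P ->
  partition P D.
Proof.
move=> sPD covP injP P0; apply/and3P; split=> //.
  rewrite eqEsubset; apply/andP; split; first exact/bigcupsP.
  by apply/subsetP=> x /covP[B PB xB]; apply/bigcupP; exists B.
apply/trivIsetP=> B B' PB PB'; apply: contraR => /pred0Pn[x /andP[/= xB xB']].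
by apply/eqP; apply: injP xB xB'.
Qed.

(** * Pulling partitions back along a map *)

Section Pullback.

Variables (T T' : finType) (f : T -> T') (D : {set T}).

Definition pullback (Q : {set {set T'}}) : {set {set T}} :=
  [set D :&: f @^-1: B | B : {set T'} in Q].

(** Each block is a union of fibres of [f] inside [D]. Among the partitions of [D], these are the
    ones obtained from partitions of [f @: D] by [pullback]. *)
Definition saturated (P : {set {set T}}) : bool :=
  [forall B in P, D :&: f @^-1: (f @: B) == B].

Lemma imset_pull (B : {set T'}) : B \subset f @: D -> f @: (D :&: f @^-1: B) = B.
Proof.
move=> /subsetP sB; apply/setP=> y; apply/imsetP/idP=> [[x]|yB].
  by rewrite !inE => /andP[_ fxB] ->.
have /imsetP[x xD yE] := sB y yB.
by exists x => //; rewrite !inE xD -yE.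
Qed.

Lemma pullback_partition (Q : {set {set T'}}) :
  partition Q (f @: D) -> partition (pullback Q) D.
Proof.
move=> pQ; apply: partitionI => [_ /imsetP[B _ ->]|x xD|B1 B2 x|].
- exact: subsetIl.
- have [B QB fxB] := partition_block_of pQ (imset_f f xD).
  by exists (D :&: f @^-1: B); [apply: imset_f | rewrite !inE xD].
- move=> /imsetP[B QB ->] /imsetP[B' QB' ->]; rewrite !inE.
  by move=> /andP[_ xB] /andP[_ xB']; rewrite (partition_eq_block pQ QB QB' xB xB').
- apply/imsetP=> -[B QB B0]; have := partition0 pQ.
  by rewrite -[set0](imset0 f) B0 imset_pull ?QB ?(partitionS pQ).
Qed.

Lemma pullback_inj : {in [set Q | partition Q (f @: D)] &, injective pullback}.
Proof.
have pullK Q : partition Q (f @: D) ->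
    [set f @: B | B : {set T} in pullback Q] = Q.
  move=> pQ; rewrite -imset_comp -[RHS]imset_id.
  by apply: eq_in_imset => B QB /=; rewrite imset_pull ?(partitionS pQ).
by move=> Q Q'; rewrite !inE => /pullK {2}<- /pullK {2}<- ->.
Qed.

Lemma saturated_pullback (Q : {set {set T'}}) :
  partition Q (f @: D) -> saturated (pullback Q).
Proof.
move=> pQ; apply/forall_inP => _ /imsetP[B QB ->].
by rewrite imset_pull ?(partitionS pQ).
Qed.

Lemma saturated_image (P : {set {set T}}) :
  partition P D -> saturated P ->
  exists2 Q, partition Q (f @: D) & P = pullback Q.
Proof.
move=> pP /forall_inP sP; exists [set f @: B | B : {set T} in P]; last first.
  rewrite /pullback -imset_comp -[LHS]imset_id.
  by apply: eq_in_imset => B PB /=; rewrite (eqP (sP B PB)).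
apply: partitionI => [_ /imsetP[B PB ->]|_ /imsetP[x xD ->]|B1 B2 y|].
- by rewrite imsetS ?(partitionS pP).
- have [B PB xB] := partition_block_of pP xD.
  by exists (f @: B); apply: imset_f.
- move=> /imsetP[B PB ->] /imsetP[B' PB' ->] /imsetP[x xB ->] fxB'.
  suff xB' : x \in B' by rewrite (partition_eq_block pP PB PB' xB xB').
  by rewrite -(eqP (sP B' PB')) !inE fxB' (subsetP (partitionS pP PB)).
- apply/imsetP=> -[B PB /esym/eqP]; rewrite imset_eq0 => /eqP B0.
  by have := partition0 pP; rewrite -B0 PB.
Qed.

Variables (U : {set T}) (U' : {set T'}).
Hypothesis U'P : forall y,
  (y \in U') = [exists x in U, D :&: f @^-1: [set y] == [set x]].

(** A block [[set x]] of the pullback can only come from the block [[set f x]], and then the fibre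
    of [f x] in [D] is [[set x]]. By [U'P], the points with such a fibre for some [x] in [U] form
    [U']. *)
Lemma pullback_no1 (Q : {set {set T'}}) : partition Q (f @: D) ->
  [forall x in U, [set x] \notin pullback Q] = [forall y in U', [set y] \notin Q].
Proof.
move=> pQ; apply/forall_inP/forall_inP => [no1 y | no1 x Ux].
  rewrite U'P => /exists_inP[x Ux /eqP yE]; apply: contra (no1 x Ux) => Qy.
  by apply/imsetP; exists [set y].
apply/imsetP=> -[B QB xE].
have BE : B = [set f x].
  by rewrite -(imset_pull (partitionS pQ QB)) -xE imset_set1.
have /no1/negP[] : f x \in U'.
  by rewrite U'P; apply/exists_inP; exists x; rewrite // xE BE.
by rewrite -BE.
Qed.

Lemma card_saturated :
  #|[set P in partitions_no1 D U | saturated P]| = #|partitions_no1 (f @: D) U'|.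
Proof.
rewrite -(card_in_imset (f := pullback)); last first.
  by apply: sub_in2 pullback_inj => Q; rewrite !inE => /andP[].
apply: eq_card => P; rewrite !inE; apply/idP/imsetP.
  move=> /andP[/andP[pP no1] sP]; have [Q pQ PE] := saturated_image pP sP.
  by exists Q; rewrite // inE pQ -pullback_no1 // -PE.
move=> [Q]; rewrite inE => /andP[pQ no1] ->.
by rewrite pullback_partition // pullback_no1 // no1 saturated_pullback.
Qed.

End Pullback.

(** * Counts depend only on cardinalities; recurrence and link with [A] *)

Lemma card_partitions_no1_inj (T T' : finType) (f : T -> T') (D U : {set T}) :
  U \subset D -> {in D &, injective f} ->
  #|partitions_no1 (f @: D) (f @: U)| = #|partitions_no1 D U|.
Proof.
move=> /subsetP sUD fI; rewrite -(@card_saturated _ _ f D U).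
  apply: eq_card => P; rewrite !inE; case: (boolP (partition P D)) => //= pP.
  (* Injectivity on [D] makes the fibres one-point sets, so every partition of [D] is saturated. *)
  rewrite andb_idr // => _; apply/forall_inP => B PB; apply/eqP/setP=> x.
  have /subsetP sB := partitionS pP PB.
  rewrite !inE; apply/andP/idP => [[xD /imsetP[x' x'B /fI->]]|xB] //; first exact: sB.
  by rewrite sB ?imset_f.
move=> y; apply/imsetP/exists_inP => [[x Ux ->]|[x Ux /eqP xE]].
  exists x => //; apply/eqP/setP=> z; rewrite !inE.
  apply/andP/eqP => [[zD /eqP /fI->]|->] //; last by rewrite sUD.
  exact: sUD.
by exists x => //; have := set11 x; rewrite -xE !inE => /andP[_ /eqP].
Qed.

Lemma card_partitions_no1_eq (T T' : finType) (y0 : T') (D U : {set T})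
    (D' U' : {set T'}) :
    U \subset D -> U' \subset D' -> #|D| = #|D'| -> #|U| = #|U'| ->
  #|partitions_no1 D U| = #|partitions_no1 D' U'|.
Proof.
move=> sUD sUD' eqD eqU.
(* Both lists put the marked points first, so matching positions carries [U] onto [U'] as well as
   [D] onto [D']; [y0] is the default value of [nth]. *)
pose s := enum U ++ enum (D :\: U); pose s' := enum U' ++ enum (D' :\: U').
have eqDU : size (enum (D :\: U)) = size (enum (D' :\: U')).
  by rewrite -!cardE !cardsD (setIidPr sUD) (setIidPr sUD') eqD eqU.
have eqs : size s = size s' by rewrite !size_cat eqDU -!cardE eqU.
have us (S : finType) (E V : {set S}) : uniq (enum V ++ enum (E :\: V)).
  rewrite cat_uniq !enum_uniq andbT /=; apply/hasPn=> x.
  by rewrite !mem_enum inE => /andP[].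
have ms (S : finType) (E V : {set S}) : V \subset E ->
    (enum V ++ enum (E :\: V)) =i E.
  move=> /subsetP sVE x; rewrite mem_cat !mem_enum inE.
  by case: (boolP (x \in V)) => // /sVE.
pose f x := nth y0 s' (index x s).
have fI : {in D &, injective f}.
  move=> x x' xD x'D /eqP; rewrite nth_uniq ?us // -?eqs ?index_mem ?ms //.
  by move=> /eqP /(congr1 (nth x s)); rewrite !nth_index ?ms.
rewrite -(card_partitions_no1_inj sUD fI).
suff [-> ->] : f @: D = D' /\ f @: U = U' by [].
have fID : #|f @: D| = #|D| by apply: card_in_imset.
have fIU : #|f @: U| = #|U|.
  by apply: card_in_imset; apply: sub_in2 fI; apply/subsetP.
split; apply/eqP; rewrite eqEcard ?fID ?fIU ?eqD ?eqU leqnn andbT.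
  apply/subsetP=> _ /imsetP[x xD ->].
  by rewrite -(ms _ _ _ sUD') mem_nth // -eqs index_mem ms.
apply/subsetP=> _ /imsetP[x xU ->].
have xs : index x s < #|U'|.
  by rewrite index_cat mem_enum xU -eqU cardE index_mem mem_enum.
by rewrite /f nth_cat -cardE xs -mem_enum mem_nth // -cardE.
Qed.

Lemma card_partitions_block1 (T : finType) (D U : {set T}) (x : T) :
    x \in D -> x \notin U ->
  #|[set P in partitions_no1 D U | [set x] \in P]| = #|partitions_no1 (D :\ x) U|.
Proof.
move=> xD xU; rewrite -(card_in_imset (f := fun P : {set {set T}} => P :\ [set x])); last first.
  move=> P P'; rewrite !inE => /andP[_ Px] /andP[_ P'x] eqP.
  by rewrite -(setD1K Px) eqP setD1K.
apply: eq_card => Q; rewrite !inE; apply/imsetP/andP.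
  move=> [P]; rewrite !inE => /andP[/andP[pP no1] Px] ->.
  split; first exact: partitionD1.
  apply/forall_inP=> y Uy; rewrite !inE negb_and.
  by rewrite (forall_inP no1 _ Uy) orbT.
move=> [pQ no1].
have Qx : [set x] \notin Q.
  by apply/negP=> /(partitionS pQ)/subsetP/(_ x (set11 x)); rewrite !inE eqxx.
exists ([set x] |: Q); last by rewrite setU1K.
rewrite !inE eqxx andbT /= -(setD1K xD) partitionU1 //=.
- apply/forall_inP=> y Uy; rewrite !inE negb_or (forall_inP no1 _ Uy) andbT.
  by rewrite (inj_eq set1_inj); apply: contraNneq xU => <-.
- by rewrite -cards_eq0 cards1.
- by rewrite disjoints1 !inE eqxx.
Qed.

(** Either [[set x]] is not a block, and [x] joins the marked points, or it is a block and can be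
    deleted. *)
Lemma card_partitions_no1_rec (T : finType) (D U : {set T}) (x : T) :
    x \in D -> x \notin U ->
  #|partitions_no1 D U| = #|partitions_no1 D (x |: U)| + #|partitions_no1 (D :\ x) U|.
Proof.
move=> xD xU; rewrite -card_partitions_block1 // addnC.
rewrite -(cardsID [set P : {set {set T}} | [set x] \in P]); congr (_ + _).
  by apply: eq_card => P; rewrite !inE.
apply: eq_card => P; rewrite !inE andbCA; congr (_ && _).
apply/andP/forall_inP => [[Px /forall_inP no1] y|no1].
  by case/setU1P=> [->|/no1].
split; first by apply: no1; rewrite setU11.
by apply/forall_inP=> y Uy; apply: no1; rewrite setU1r.
Qed.

Lemma A_partitions_no1 (T : finType) (x0 : T) (D U : {set T}) (m k : nat) :
    U \subset D -> #|U| = m -> #|D| = m + k ->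
  A (m + k) k = #|partitions_no1 D U|.
Proof.
move=> sUD cU cD.
have ltk : k < (m + k).+1 by rewrite ltnS leq_addl.
(* Here [i] is the largest singleton, to be deleted; the [m] ordinals above it become the marked
   points. *)
pose i := Ordinal ltk; pose V := [set j : 'I_(m + k).+1 | k < j].
have iV : i \notin V by rewrite inE ltnn.
have cV : #|V| = m.
  have := cardsC V; rewrite card_ord.
  have -> : #|~: V| = k.+1.
    have wI : injective (widen_ord ltk).
      by move=> j j' /(congr1 val) /= /val_inj.
    rewrite -[RHS]card_ord -(card_imset _ wI).
    apply: eq_card => j; rewrite !inE -leqNgt; apply/idP/imsetP => [jk|[j' _ ->]].
      by exists (Ordinal (jk : j < k.+1)) => //; apply: val_inj.
    exact: (ltn_ord j').
  by rewrite addnS => -[/eqP]; rewrite eqn_add2r => /eqP.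
rewrite -(card_partitions_no1_eq x0 (D := [set: 'I_(m + k).+1] :\ i) (U := V) _ sUD).
- rewrite /A -card_partitions_block1 ?in_setT //; apply: eq_card => P; rewrite !inE.
  rewrite /largest_singleton -andbA; congr (_ && _); rewrite andbC; congr (_ && _).
    by apply: eq_forallb => j; rewrite inE.
  apply/existsP/idP => [[j /andP[/eqP jk]]|Pi]; last by exists i; rewrite eqxx.
  by rewrite (_ : j = i) //; apply: val_inj.
- by apply/subsetP=> j Vj; rewrite !inE andbT; apply: contraNneq iV => <-.
- by have := cardsT 'I_(m + k).+1; rewrite (cardsD1 i) inE card_ord cD => -[].
- by rewrite cV.
Qed.

(** * Rotation of [p] marked points and the congruence modulo [p] *)

Lemma perm_partitions_no1 (T : finType) (U : {set T}) (a : {perm T})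
    (P : {set {set T}}) :
    (forall x, (a x \in U) = (x \in U)) ->
  (('P^*)^*%act P a \in partitions_no1 setT U) = (P \in partitions_no1 setT U).
Proof.
move=> aU; have aT : a @: setT = setT.
  by apply/eqP; rewrite eqEcard subsetT card_imset ?leqnn //; apply: perm_inj.
rewrite !inE -[in LHS]aT imset_partition; last exact: perm_inj.
congr (_ && _); apply/forall_inP/forall_inP => no1 x Ux.
  have := no1 (a x); rewrite aU => /(_ Ux); apply: contra => Px.
  by apply/imsetP; exists [set x] => //; rewrite /= setactE imset_set1.
apply/imsetP=> -[B PB /= xE].
have /cards1P[y yE] : #|B| == 1.
  by rewrite -(card_imset _ (@perm_inj _ a)) -[_ @: _]xE cards1.
move: xE; rewrite yE /= setactE imset_set1 => /set1_inj xE.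
have /negP[] : [set y] \notin P by apply: no1; rewrite -aU -[a y]xE.
by rewrite -yE.
Qed.

Section Touchard.

Variables (p m k : nat).
Hypothesis p_prime : prime p.

(** ['F_p] holds the rotated points, ['I_m] the other marked points and ['I_k] the unmarked ones. In
    [T'] the rotated points have collapsed to one. The field structure of ['F_p] lets any nonzero
    shift generate all rotations. *)
Local Notation T := (('F_p + 'I_m) + 'I_k)%type.
Local Notation T' := ((unit + 'I_m) + 'I_k)%type.

Definition translate (t : 'F_p) (x : T) : T :=
  if x is inl (inl a) then inl (inl (a + t)%R) else x.

Definition contract (x : T) : T' :=
  match x with
  | inl (inl _) => inl (inl tt)
  | inl (inr i) => inl (inr i)
  | inr j => inr j
  end.

Lemma translate_inj t : injective (translate t).
Proof.
apply: (@can_inj _ _ _ (translate (- t)%R)).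
by case=> [[a|i]|j] //=; rewrite GRing.addrK.
Qed.

Definition cyc : {perm T} := perm (@translate_inj 1%R).

Lemma cycX n x : (cyc ^+ n)%g x = translate n%:R%R x.
Proof.
elim: n x => [|n IHn] x.
  by rewrite expg0 perm1; case: x => [[a|i]|j] //=; rewrite GRing.addr0.
rewrite expgSr permM IHn permE.
by case: x => [[a|i]|j] //=; rewrite -GRing.addrA GRing.natr1.
Qed.

Lemma pgroup_cyc : p.-group%g <[cyc]>%g.
Proof.
apply: (@pnat_dvd _ p); last exact: pnat_id.
rewrite -orderE order_dvdn; apply/eqP/permP => x.
rewrite cycX perm1 pchar_Fp_0 //.
by case: x => [[a|i]|j] //=; rewrite GRing.addr0.
Qed.

Definition marked : {set T} := inl @: [set: 'F_p + 'I_m].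

Lemma mem_cyc_marked a x : a \in <[cyc]>%g -> (a x \in marked) = (x \in marked).
Proof.
move=> /cycleP[n ->]; rewrite cycX.
by case: x => [[b|i]|j] //=; rewrite !imset_f ?inE.
Qed.

(** Only the fibre of rotated points has more than one element, so saturation means that one block
    contains all of them. *)
Lemma fixed_saturated P : P \in partitions_no1 setT marked ->
  (P \in 'Fix_('P^*^*)(<[cyc]>)%g) = saturated contract setT P.
Proof.
rewrite inE => /andP[pP /forall_inP no1]; apply/afixP/forall_inP => [fixP B PB|sP a].
  have PcB t B' : B' \in P -> translate t @: B' \in P.
    move=> PB'; rewrite -[P](fixP (cyc ^+ t)%g) ?mem_cycle //.
    apply/imsetP; exists B' => //=; rewrite setactE; apply: eq_imset => x /=.
    by rewrite /aperm cycX natr_Zp.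
  (* The translate of [B] is a block by [PcB]; if it meets [B], it equals [B]. *)
  have stB t x y : x \in B -> translate t x \in B -> y \in B -> translate t y \in B.
    move=> xB txB yB; suff <- : translate t @: B = B by apply: imset_f.
    by apply: (partition_eq_block pP) txB => //; [apply: PcB | apply: imset_f].
  rewrite setTI eqEsubset; apply/andP; split; last first.
    by apply/subsetP=> x xB; rewrite inE imset_f.
  apply/subsetP=> y; rewrite inE => /imsetP[x xB].
  case: x xB => [[a|i]|j] xB; case: y => [[b|i']|j'] //=; try by move=> [->].
  (* The rotated point [a] is marked, hence not alone in [B]: there is a second point [z]. *)
  move=> _; have /set0Pn[z /setD1P[zx zB]] : B :\ inl (inl a) != set0.
    have /no1 : inl (inl a) \in marked by rewrite imset_f ?inE.
    by apply: contraNneq => B0; rewrite -[[set _]]setU0 -B0 setD1K.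
  have trE c : inl (inl c) = translate (c - a)%R (inl (inl a)).
    by rewrite /= GRing.addrC GRing.subrK.
  case: z zx zB => [[c|i]|j] zx zB.
  (* If [z] is a rotated point [c], the shift by [c - a] preserves [B]; repeating it
     [(b - a) / (c - a)] times, read as a natural number, leads from [a] to [b]. *)
  - have nca : (c - a)%R != 0%R.
      by rewrite GRing.subr_eq0; apply: contraNneq zx => ->.
    have stBn n : translate ((c - a) *+ n)%R (inl (inl a)) \in B.
      elim: n => [|n IHn]; first by rewrite GRing.mulr0n /= GRing.addr0.
      rewrite GRing.mulrSr /= GRing.addrA; apply: (stB _ _ _ xB _ IHn).
      by rewrite -trE.
    have := stBn ((b - a) / (c - a) : 'F_p)%R.
    by rewrite -GRing.mulr_natr natr_Zp GRing.mulrC GRing.divfK // -trE.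
  (* A point outside ['F_p] is fixed by every translation, so each translation preserves [B],
     including the one taking [a] to [b]. *)
  - by rewrite trE; apply: (stB _ _ _ zB zB xB).
  - by rewrite trE; apply: (stB _ _ _ zB zB xB).
(* Conversely, rotations do not change the value of [contract], so they preserve each saturated
   block. *)
move=> /cycleP[n ->] /=; rewrite setactE -[RHS]imset_id.
apply: eq_in_imset => B PB /=; rewrite setactE; apply/eqP.
rewrite eqEcard card_imset ?leqnn ?andbT; last exact: act_inj.
apply/subsetP=> _ /imsetP[x xB ->]; rewrite -(eqP (sP B PB)) setTI inE.
apply/imsetP; exists x => //=; rewrite /aperm cycX.
by case: x {xB} => [[]|].
Qed.

Lemma A_touchard : A (m + p + k) k = A (m.+1 + k) k + A (m + k) k %[mod p].
Proof.
pose o : T' := inl (inl tt).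
pose U' : {set T'} := (fun i => inl (inr i)) @: [set: 'I_m].
have oU' : o \notin U' by apply/imsetP=> -[].
have cU' : #|U'| = m by rewrite card_imset ?cardsT ?card_ord // => i j [].
have cT' : #|[set: T']| = m.+1 + k.
  by rewrite cardsT !card_sum card_unit !card_ord add1n.
rewrite (@A_partitions_no1 T (inl (inl 0%R)) setT marked (m + p) k); last 3 first.
- exact: subsetT.
- rewrite card_imset; last by move=> x y [].
  by rewrite cardsT card_sum card_Fp // card_ord addnC.
- by rewrite cardsT !card_sum card_Fp // !card_ord (addnC m).
rewrite (@A_partitions_no1 T' o setT (o |: U') m.+1 k) ?subsetT //; last first.
  by rewrite cardsU1 oU' cU'.
rewrite (@A_partitions_no1 T' o (setT :\ o) U' m k) //; last 2 first.
- by apply/subsetP=> x xU'; rewrite !inE andbT; apply: contraNneq oU' => <-.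
- by have := cT'; rewrite (cardsD1 o) inE => -[].
(* The two terms on the right are the cases of the recurrence at [o]; their sum counts the
   partitions of [T'] with [o] unmarked. *)
rewrite -card_partitions_no1_rec ?in_setT //.
(* Modulo [p], only the partitions fixed by the [p]-group of rotations count. *)
rewrite (pgroup_fix_mod (to := ('P^*)^*%act) pgroup_cyc); last first.
  by apply/actsP=> a ca P; apply: perm_partitions_no1 => x; apply: mem_cyc_marked.
have cT : contract @: setT = setT.
  apply/setP=> x; rewrite inE; apply/imsetP.
  by case: x => [[[]|i]|j]; [exists (inl (inl 0%R)) | exists (inl (inr i)) | exists (inr j)].
rewrite -[in RHS]cT -(card_saturated (f := contract) (U := marked)).
  congr (_ %% _); apply: eq_card => P; rewrite in_setI [RHS]inE.
  by case: (boolP (P \in _)) => // /fixed_saturated.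
move=> y; apply/imsetP/exists_inP => [[i _ ->]|[x xU]].
  exists (inl (inr i)); first by rewrite imset_f ?inE.
  by apply/eqP/setP=> -[[a|i']|j]; rewrite !inE.
case: y => [[[]|i]|j] /eqP xE.
(* The fibre over [o] contains both 0 and 1, which differ in ['F_p]; this is why [o] is unmarked. *)
- have : inl (inl 0%R) \in [set x] by rewrite -xE !inE.
  have : inl (inl 1%R) \in [set x] by rewrite -xE !inE.
  by rewrite !inE => /eqP<- /eqP[] /eqP; rewrite eq_sym GRing.oner_eq0.
- by exists i.
- have : inr j \in [set x] by rewrite -xE !inE /=.
  by rewrite inE => /eqP xj; case/imsetP: xU => ? _; rewrite -xj.
Qed.

End Touchard.

(** * Binomial iteration and the triangular system *)

Lemma touchard_binomial (R : nmodType) (u : nat -> R) (p : nat) :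
    (forall m, u (m + p) = (u m.+1 + u m)%R) ->
  forall m n, (u (n + p * m)%N = \sum_(j < m.+1) u (n + j)%N *+ 'C(m, j))%R.
Proof.
(* With [E] the shift operator, the hypothesis reads [E^p = E + 1], and the claim expands
   [E^(p m) = (E + 1)^m]; the induction on [m] uses Pascal's rule. *)
move=> urec; elim=> [|m IHm] n.
  by rewrite big_ord_recl big_ord0 muln0 /= !addn0 bin0 GRing.mulr1n GRing.addr0.
rewrite mulnS addnA IHm [in RHS]big_ord_recl /= bin0.
rewrite (eq_bigr (fun j : 'I_m.+1 =>
  u (n + j).+1 *+ 'C(m, j) + u (n + j)%N *+ 'C(m, j))%R) => [|j _]; last first.
  by rewrite addnAC urec GRing.mulrnDl.
rewrite [in RHS](eq_bigr (fun j : 'I_m.+1 =>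
  u (n + j).+1 *+ 'C(m, j.+1) + u (n + j).+1 *+ 'C(m, j))%R) => [|j _]; last first.
  by rewrite -[bump 0 j]/j.+1 binS GRing.mulrnDr addnS.
rewrite !big_split /= GRing.addrC GRing.addrA; congr (_ + _)%R.
rewrite big_ord_recl [in RHS]big_ord_recr /= bin0 bin_small // GRing.mulr0n GRing.addr0.
by congr (_ + _)%R; apply: eq_bigr => j _; rewrite addnS.
Qed.

Lemma eq_Fp_nat (p a b : nat) : prime p ->
  (a%:R = b%:R :> 'F_p)%R <-> a = b %[mod p].
Proof.
move=> p_prime; rewrite -!(val_Fp_nat p_prime).
by split=> [->|/val_inj].
Qed.

Theorem theorem4p7 (n k p : nat) (p_prime : prime p) :
  (forall m : nat, 0 <= m <= p - 2 -> A (n + m + k) k = 0 %[mod p])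
  <->
  (forall m : nat, 1 <= m <= p - 1 ->
     A (n + m + k) k = A (n + p * m + k) k %[mod p]).
Proof.
pose u m : 'F_p := (A (m + k) k)%:R%R.
have urec m : u (m + p) = (u m.+1 + u m)%R.
  by rewrite /u -GRing.natrD; apply/eq_Fp_nat => //; apply: A_touchard.
(* With the term [j = m] split off, the congruence for [m] says that the sum over [j < m]
   vanishes. *)
have uE m : u (n + p * m) = (\sum_(j < m) u (n + j)%N *+ 'C(m, j) + u (n + m)%N)%R.
  by rewrite (touchard_binomial urec) big_ord_recr /= binn GRing.mulr1n.
have p_gt1 := prime_gt1 p_prime.
split=> [u0 m /andP[m_gt0 le_mp]|uM].
  apply/eq_Fp_nat => //; rewrite -/(u (n + m)) -/(u (n + p * m)) uE.
  rewrite big1 ?GRing.add0r // => j _.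
  suff -> : u (n + j) = 0%R by rewrite GRing.mul0rn.
  apply/(eq_Fp_nat _ 0) => //; apply: u0.
  by have := ltn_ord j; lia.
elim/ltn_ind => m IHm le_mp; apply/eq_Fp_nat => //; rewrite -/(u (n + m)).
(* The congruence with index [m + 1] determines the term of index [m]: the earlier terms vanish by
   induction, leaving [u (n + m)] times ['C(m.+1, m) = m.+1], which is nonzero modulo [p]. *)
have lt_mp : m.+1 < p by lia.
have /uM/eq_Fp_nat : 1 <= m.+1 <= p - 1 by lia.
rewrite -/(u (n + m.+1)) -/(u (n + p * m.+1)) => /(_ p_prime)/esym/eqP.
rewrite uE -GRing.subr_eq0 GRing.addrK big_ord_recr big1 => [|j _]; last first.
  suff -> : u (n + j) = 0%R by rewrite GRing.mul0rn.
  by apply/(eq_Fp_nat _ 0) => //; apply: IHm; have := ltn_ord j; lia.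
rewrite /= GRing.add0r binSn -(GRing.mulr_natr (u _)) GRing.mulf_eq0 => /orP[/eqP //|].
by move=> /eqP /(proj1 (eq_Fp_nat m.+1 0 p_prime)); rewrite mod0n modn_small.
Qed.
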